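(* Let $\{T_\alpha \mid 1 \le \alpha < \omega_1\}$ be the family of rooted trees constructed below, with any admissible choice of the functions $\psi_\beta$ at the limit stages. Then for all ordinals $\alpha, \beta$ with $1 \le \alpha < \beta < \omega_1$ we have $T_\alpha \preceq T_\beta$ and $T_\beta \not\preceq T_\alpha$.
   Context: All trees are locally finite. A rooted tree $T$ carries its tree-order: $a \le b$ iff $a$ lies on the path from the root of $T$ to $b$. For rooted trees $T, U$, write $T \preceq U$ ($T$ is a topological minor of $U$) if some subdivision $T'$ of $T$ is isomorphic to a subtree of $U$ via an isomorphism $\phi$ preserving tree-order: $x \le y$ in $T'$ implies $\phi(x) \le \phi(y)$ in $U$. Equivalently, there is a tree-order preserving embedding of $T$ into $U$ in this sense. ''Attaching'' a rooted tree to a vertex $v$ means joining $v$ by a new edge to the root of a fresh disjoint copy of that tree. The construction is by transfinite recursion on $1 \le \beta < \omega_1$: - $T_1$ is a ray $v_1 v_2 v_3 \ldots$ rooted at $v_1$. - If $\beta = \alpha + 1$, take a ray $R = v_1 v_2 v_3\ldots$ rooted at $v_1$ (the spine) and attach to each $v_i$ its own copy of $T_\alpha$. The result $T_\beta$ has root $v_1$. - If $\beta$ is a limit ordinal, choose any strictly increasing function $\psi_\beta : \omega \to \beta \setminus \{0\}$ whose range is cofinal in $\beta$. Take a ray $R = v_1 v_2 \ldots$ rooted at $v_1$ (the spine) and attach to each $v_i$ its own copy of $T_{\psi_\beta(i)}$. The result $T_\beta$ has root $v_1$. *)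

(* Defs.v *)
From HB Require Import structures.
From mathcomp Require Import all_boot all_order.
From mathcomp Require Import boolp classical_sets functions cardinality.
From mathcomp Require wochoice.

Set Implicit Arguments.
Unset Strict Implicit.
Unset Printing Implicit Defensive.

Import Order.TTheory.
Local Open Scope classical_set_scope.

(* A closed walk [a; b] along a single edge is a ucycle of size 2, so genuine
   cycles are those with at least three vertices. *)
Definition acyclic (V : eqType) (E : rel V) : Prop :=
  forall c : seq V, ucycle E c -> size c <= 2.

Definition connected_on (V : eqType) (S : pred V) (E : rel V) : Prop :=
  forall x y, S x -> S y -> exists2 p, path E x p & last x p = y.

(* The graph with vertex set S and edge relation E is a (nonempty) tree. *)
Record tree_on (V : eqType) (S : pred V) (E : rel V) : Prop := TreeOn {
  tree_sym : symmetric E;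
  tree_irr : irreflexive E;
  tree_inc : forall x y, E x y -> S x && S y;
  tree_nonempty : exists x, S x;
  tree_connected : connected_on S E;
  tree_acyclic : acyclic E }.

Definition locally_finite (V : eqType) (E : rel V) : Prop :=
  forall x, finite_set [set y | E x y].

Record rtree := RTree {
  vertex :> eqType;
  adj : rel vertex;
  root : vertex;
  rtree_tree : tree_on predT adj;
  rtree_locally_finite : locally_finite adj }.

Arguments adj {r}.
Arguments root {r}.

Definition tree_le (T : rtree) (a b : T) : Prop :=
  exists p : seq T,
    [/\ path adj root p, uniq (root :: p), last root p = b & a \in root :: p].

Definition rtree_iso (T U : rtree) : Prop :=
  exists f : T -> U,
    [/\ bijective f, f root = root & {mono f : x y / adj x y}].

Definition subtree (U : rtree) (S : pred U) (F : rel U) : Prop :=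
  tree_on S F /\ (forall x y, F x y -> adj x y).

(* T' arises from T by replacing the edges of T with independent paths, the
   roots being identified: b embeds the vertices of T in T' and sub x y lists,
   from x to y, the new vertices drawn on the edge xy. *)
Definition subdivision_path (T T' : rtree) (b : T -> T')
    (sub : T -> T -> seq T') (x y : T) : seq T' :=
  b x :: rcons (sub x y) (b y).

Record is_subdivision (T T' : rtree) (b : T -> T')
    (sub : T -> T -> seq T') : Prop := IsSubdivision {
  subdiv_inj : injective b;
  subdiv_root : b root = root;
  subdiv_path : forall x y, adj x y ->
    path adj (b x) (rcons (sub x y) (b y)) /\ uniq (subdivision_path b sub x y);
  subdiv_rev : forall x y, adj x y -> sub y x = rev (sub x y);
  subdiv_new : forall x y z, adj x y -> b z \notin sub x y;
  subdiv_indep : forall x y x' y' u, adj x y -> adj x' y' ->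
    u \in sub x y -> u \in sub x' y' ->
    (x = x' /\ y = y') \/ (x = y' /\ y = x');
  subdiv_vertices : forall u,
    (exists x, u = b x) \/ (exists x y, adj x y /\ u \in sub x y);
  subdiv_edges : forall u v, adj u v ->
    exists x y, adj x y /\ infix [:: u; v] (subdivision_path b sub x y) }.

Definition subdivision (T T' : rtree) : Prop :=
  exists b sub, @is_subdivision T T' b sub.

Definition iso_onto (T' U : rtree) (phi : T' -> U) (S : pred U) (F : rel U)
    : Prop :=
  [/\ injective phi, (forall u, S u <-> exists x, phi x = u)
    & forall x y, F (phi x) (phi y) = adj x y].

Definition topological_minor (T U : rtree) : Prop :=
  exists T' : rtree, subdivision T T' /\
    exists (S : pred U) (F : rel U) (phi : T' -> U),
      [/\ subtree S F, iso_onto phi S F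
        & forall x y, tree_le x y -> tree_le (phi x) (phi y)].

Definition ray_adj (i j : nat) : bool := (j == i.+1) || (i == j.+1).

Section Walks.
Variables (V : eqType) (E : rel V).

Definition joined x y := exists2 p, path E x p & last x p = y.

Lemma joined_refl x : joined x x. Proof. by exists [::]. Qed.

Lemma joined_edge x y : E x y -> joined x y.
Proof. by move=> e; exists [:: y] => //=; rewrite e. Qed.

Lemma joined_trans x y z : joined x y -> joined y z -> joined x z.
Proof.
move=> [p pp <-] [q pq <-]; exists (p ++ q); first by rewrite cat_path pp.
by rewrite last_cat.
Qed.

Hypothesis symE : symmetric E.

Lemma joined_sym x y : joined x y -> joined y x.
Proof.
move=> [p pp <-]; exists (rev (belast x p)).
  by rewrite rev_path (eq_path (e' := E)) // => u v /=; rewrite symE.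
by case: p pp => //= a p _; rewrite rev_cons last_rcons.
Qed.

(* A cycle cannot cross a bridge ra separating A from its complement. *)
Lemma bridge_cycle (A : pred V) r a c :
  (forall x y, E x y -> A x -> ~~ A y -> x = r /\ y = a) ->
  ucycle E c -> 2 < size c -> all A c || all (predC A) c.
Proof.
move=> bridge.
have stay (B : pred V) s x : (forall u v, E u v -> B u -> u \in x :: s ->
    v \in s -> B v) -> path E x s -> B x -> all B s.
  elim: s x => //= y s IH x HB /andP[exy ps] Bx.
  have By : B y by apply: (HB x y) => //; rewrite ?mem_head ?inE ?eqxx.
  rewrite By; apply: (IH y) => // u v euv Bu us vs.
  by apply: (HB u v) => //; rewrite inE ?us ?vs orbT.
have noA (B : pred V) s x : (forall u v, E u v -> B u -> ~~ B v ->
    u \in x :: s -> v \in s -> False) -> path E x s -> B x -> all B s.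
  move=> H; apply: stay => u v euv Bu us vs; apply/negPn/negP => Bv.
  exact: (H u v).
move=> /andP[cyc un] sz.
have [rc|rc] := boolP (r \in c); last first.
  case: c cyc un sz rc => //= x p cyc un sz rc.
  move: cyc; rewrite rcons_path => /andP[pp _].
  have [Ax|Ax] := boolP (A x).
    rewrite (noA A p x) //= => u v euv Au Av us _.
    by have [ur _] := bridge _ _ euv Au Av; rewrite -ur us in rc.
  rewrite (noA (predC A) p x) ?orbT //= => u v euv Au /negPn Av _ vs.
  rewrite symE in euv; have [vr _] := bridge _ _ euv Av Au.
  by rewrite -vr inE vs orbT in rc.
have [k c' Ec] := rot_to rc.
have cyc' : cycle E (r :: c') by rewrite -Ec rot_cycle.
have un' : uniq (r :: c') by rewrite -Ec rot_uniq.
have sz' : 2 < size (r :: c') by rewrite -Ec size_rot.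
have allr (B : pred V) : all B c = all B (r :: c').
  by rewrite -Ec /rot all_cat andbC -all_cat cat_take_drop.
rewrite !allr {allr Ec cyc un sz rc c k}.
have [Ar|Ar] := boolP (A r); last first.
  move: cyc' un' => /=; rewrite rcons_path => /andP[pp _] /andP[rn _].
  rewrite /= Ar (noA (predC A) c' r) ?orbT //= => u v euv Au /negPn Av _ vs.
  rewrite symE in euv; have [vr _] := bridge _ _ euv Av Au.
  by rewrite -vr vs in rn.
have [ac|ac] := boolP (a \in c'); last first.
  move: cyc' => /=; rewrite rcons_path => /andP[pp _].
  rewrite /= Ar (noA A c' r) //= => u v euv Au Av _ vs.
  by have [_ va] := bridge _ _ euv Au Av; rewrite -va vs in ac.
have [Aa|Aa] := boolP (A a).
  move: cyc' => /=; rewrite rcons_path => /andP[pp _].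
  rewrite /= Ar (noA A c' r) //= => u v euv Au Av _ vs.
  by have [_ va] := bridge _ _ euv Au Av; rewrite va Aa in Av.
case/splitPr: ac cyc' un' sz' => p1 p2.
rewrite /= rcons_cat cat_path /= rcons_path => /and3P[pp1 e1 /andP[pp2 e2]].
rewrite mem_cat inE !negb_or cat_uniq /= !negb_or.
move=> /andP[/and3P[rp1 ra rp2] /and3P[_ /andP[ap1 _] /andP[ap2 _]]] sz.
exfalso.
have p10 : p1 = [::].
  case/lastP: p1 pp1 e1 rp1 ap1 sz => // p1 x pp1 e1 rp1 ap1 _.
  have Ap1 : all A (rcons p1 x).
    apply: (noA A _ r) => // u v euv Au Av us vs.
    by have [_ va] := bridge _ _ euv Au Av; rewrite -va vs in ap1.
  rewrite last_rcons in e1; move: Ap1; rewrite all_rcons => /andP[Ax _].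
  have [xr _] := bridge _ _ e1 Ax Aa.
  by rewrite -xr mem_rcons mem_head in rp1.
subst p1; case/lastP: p2 pp2 e2 rp2 ap2 sz => // p2 x pp2 e2 rp2 ap2 _.
have Ap2 : all (predC A) (rcons p2 x).
  apply: (noA (predC A) _ a) => // u v euv Au /negPn Av us vs.
  rewrite symE in euv; have [vr _] := bridge _ _ euv Av Au.
  by rewrite -vr vs in rp2.
rewrite last_rcons symE in e2; move: Ap2; rewrite all_rcons => /andP[Ax _].
have [_ xa] := bridge _ _ e2 Ar Ax.
by rewrite -xa mem_rcons mem_head in ap2.
Qed.

End Walks.

Lemma ray_tree : tree_on predT ray_adj.
Proof.
have symr : symmetric ray_adj by move=> i j; rewrite /ray_adj orbC.
have crossing k x y : ray_adj x y -> x <= k -> ~~ (y <= k) -> x = k /\ y = k.+1.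
  rewrite /ray_adj -ltnNge => /orP[/eqP->|/eqP->] h1 h2; last first.
    by have := leq_trans (leqW h1) h2; rewrite ltnn.
  have -> : x = k by apply/eqP; rewrite eqn_leq h1 -ltnS.
  by [].
split=> //.
- by move=> i; rewrite /ray_adj orbb; elim: i.
- by exists 0.
- have up i : joined ray_adj 0 i.
    elim: i => [|i IH]; first exact: joined_refl.
    by apply: joined_trans IH (joined_edge _); rewrite /ray_adj eqxx.
  by move=> x y _ _; apply: joined_trans (joined_sym symr (up x)) (up y).
- move=> c uc; rewrite leqNgt; apply/negP => sz.
  have low i j : i \in c -> j \in c -> j <= i.
    move=> ic jc.
    have /orP[/allP h|/allP h] := bridge_cycle (A := fun k => k <= i)
        (r := i) (a := i.+1) symr (crossing i) uc sz; first exact: h.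
    by have := h _ ic; rewrite /= leqnn.
  case: c uc sz low => [|x [|y c]] // /andP[_ un] _ low.
  have xc : x \in [:: x, y & c] by rewrite mem_head.
  have yc : y \in [:: x, y & c] by rewrite !inE eqxx orbT.
  have xy : x = y by apply/eqP; rewrite eqn_leq !low.
  by move: un; rewrite xy /= mem_head.
Qed.

Lemma ray_locally_finite : locally_finite ray_adj.
Proof.
move=> x; apply: (sub_finite_set (B := [set` [:: x.+1; x.-1]])).
  move=> y /= /orP[/eqP->|/eqP->]; first by rewrite mem_head.
  by rewrite !inE eqxx orbT.
exact: finite_seq.
Qed.

(* The vertex v_(n+1) of the ray v_1 v_2 v_3 ... is encoded by n : nat. *)
Definition ray : rtree := RTree 0 ray_tree ray_locally_finite.

Section Attach.
Variables (T : rtree) (X : T -> rtree).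

(* inl v is the vertex v of T; inr (Tagged _ x) with x : X v is the vertex x of
   the copy of X v attached to v. *)
Definition attach_vertex : eqType := (T + {v : T & X v})%type.

Definition attach_adj (a b : attach_vertex) : bool :=
  match a, b with
  | inl v, inl w => adj v w
  | inl v, inr y => (v == tag y) && (tagged y == root)
  | inr x, inl w => (w == tag x) && (tagged x == root)
  | inr x, inr y => (tag x == tag y) && adj (tagged x) (tagged_as x y)
  end.

Let inX (v : T) (x : X v) : attach_vertex := inr (Tagged X x).

Lemma attach_adjr v (x y : X v) : attach_adj (inX x) (inX y) = adj x y.
Proof. by rewrite /= eqxx tagged_asE. Qed.

Lemma attach_sym : symmetric attach_adj.
Proof.
move=> [v|[v x]] [w|[w y]] //=; first exact: (tree_sym (rtree_tree T)).
have [vw|//] := eqVneq v w.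
by subst w; rewrite !tagged_asE (tree_sym (rtree_tree (X v))).
Qed.

Lemma attach_tree : tree_on predT attach_adj.
Proof.
split=> //.
- exact: attach_sym.
- move=> [v|[v x]] /=; first exact: (tree_irr (rtree_tree T)).
  by rewrite tagged_asE eqxx (tree_irr (rtree_tree (X v))).
- by exists (inl root).
- have base v w : joined attach_adj (inl v) (inl w).
    have [p pp <-] := tree_connected (rtree_tree T) (x := v) (y := w) isT isT.
    exists (map inl p); last by rewrite last_map.
    by rewrite path_map.
  have toroot a : joined attach_adj (inl root) a.
    case: a => [v|[v x]]; first exact: base.
    apply: joined_trans (base _ v) _.
    apply: (@joined_trans _ _ _ (inX (root : X v))).
      by apply: joined_edge; rewrite /= !eqxx.
    have [p pp <-] :=
      tree_connected (rtree_tree (X v)) (x := root) (y := x) isT isT.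
    exists (map (@inX v) p); last by rewrite (last_map (@inX v)).
    rewrite path_map; rewrite (eq_path (e' := adj)) // => a b /=.
    exact: attach_adjr.
  move=> a b _ _.
  exact: joined_trans (joined_sym attach_sym (toroot a)) (toroot b).
- move=> c uc; rewrite leqNgt; apply/negP => sz.
  pose A v (a : attach_vertex) := if a is inr x then tag x == v else false.
  have cross v a b : attach_adj a b -> A v a -> ~~ A v b ->
      a = inX (root : X v) /\ b = inl v.
    case: a b => [u|[u x]] [w|[w y]] //=.
      by move=> /andP[/eqP-> /eqP->] /eqP uv _; subst u.
    by move=> /andP[/eqP uw _] /eqP uv /eqP[]; rewrite -uw.
  have dich v := bridge_cycle attach_sym (cross v) uc sz.
  have [|noA] := pselect (exists v, all (A v) c).
    move=> [v Av].
    have [s Es] : exists s, c = map (@inX v) s.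
      elim: c Av {uc sz dich} => [|a c IH] /=; first by exists [::].
      move=> /andP[Aa /IH[s ->]]; case: a Aa => // -[u x] /= /eqP uv.
      by subst u; exists (x :: s).
    have injX : injective (@inX v).
      by move=> x y [] /eqP; rewrite eq_Tagged => /eqP.
    suff : size s <= 2 by move: sz; rewrite Es size_map ltnNge => /negP.
    apply: (tree_acyclic (rtree_tree (X v))).
    move: uc; rewrite /ucycle Es map_inj_uniq // => /andP[cy ->]; rewrite andbT.
    by rewrite -(mono_cycle (@attach_adjr v)).
  have [s Es] : exists s, c = map inl s.
    have noA' v : all (predC (A v)) c.
      by have /orP[h|//] := dich v; case: noA; exists v.
    elim: c noA' {uc sz dich noA} => [|a c IH] noA /=; first by exists [::].
    have [s ->] : exists s, c = [seq inl i | i <- s].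
      by apply: IH => v; have /andP[] := noA v.
    case: a noA => [v|x] noA; first by exists (v :: s).
    by have := noA (tag x); rewrite /= eqxx.
  suff : size s <= 2 by move: sz; rewrite Es size_map ltnNge => /negP.
  apply: (tree_acyclic (rtree_tree T)).
  move: uc; rewrite /ucycle Es map_inj_uniq; last by move=> x y [].
  by rewrite (mono_cycle (e := adj)).
Qed.

Lemma attach_locally_finite : locally_finite attach_adj.
Proof.
move=> [v|[v x]].
  have /finite_seqP[s Es] := rtree_locally_finite v.
  apply: (sub_finite_set
    (B := [set` inX (root : X v) :: map inl s])); last exact: finite_seq.
  move=> [w|[w y]] /=.
    move=> vw; rewrite inE /= map_f //.
    by have : [set` s] w by rewrite -Es.
  by move=> /andP[/eqP vw /eqP yr]; subst w; rewrite yr mem_head.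
have /finite_seqP[s Es] := rtree_locally_finite x.
apply: (sub_finite_set
  (B := [set` inl v :: map (@inX v) s])); last exact: finite_seq.
move=> [w|[w y]] /=; first by move=> /andP[/eqP-> _]; rewrite mem_head.
move=> /andP[/eqP vw]; subst w; rewrite tagged_asE => xy.
rewrite inE /=; apply: (map_f (@inX v)).
by have : [set` s] y by rewrite -Es.
Qed.

Definition attach : rtree :=
  RTree (inl root) attach_tree attach_locally_finite.

End Attach.

(* A well-ordered set has order type omega_1 iff it is uncountable and all its
   proper initial segments are countable; its elements then represent the
   ordinals below omega_1. *)
Definition omega1 (d : Order.disp_t) (O : orderType d) : Prop :=
  [/\ wochoice.well_order (<=%O : rel O),
      (forall a : O, countable [set b : O | (b < a)%O])
    & ~ countable [set: O]].

Section Ordinals.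
Variables (d : Order.disp_t) (O : orderType d).
Implicit Types a b : O.

Definition is_zero a : Prop := forall b, (a <= b)%O.

Definition is_succ a b : Prop :=
  (a < b)%O /\ forall c, (a < c)%O -> (b <= c)%O.

Definition is_one a : Prop := exists2 z, is_zero z & is_succ z a.

Definition is_limit b : Prop := ~ is_zero b /\ forall a, ~ is_succ a b.

(* psi b is only constrained at limits b. *)
Definition admissible (psi : O -> nat -> O) : Prop :=
  forall b, is_limit b ->
    [/\ (forall n, ~ is_zero (psi b n) /\ (psi b n < b)%O),
        (forall m n, m < n -> (psi b m < psi b n)%O)
      & (forall a, (a < b)%O -> exists n, (a <= psi b n)%O)].

(* The value of T at zero is irrelevant; trees are only determined up to
   root-preserving isomorphism. *)
Record tree_family (psi : O -> nat -> O) (T : O -> rtree) : Prop := TreeFamily {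
  family_one : forall b, is_one b -> rtree_iso (T b) ray;
  family_succ : forall a b, ~ is_zero a -> is_succ a b ->
    rtree_iso (T b) (attach (T := ray) (fun _ => T a));
  family_limit : forall b, is_limit b ->
    rtree_iso (T b) (attach (T := ray) (fun n => T (psi b n))) }.

End Ordinals.

(* Main.v *)
(* No subdivision is needed for T_a <= T_b: by induction on b, T_a occurs as a
   subtree of T_b inside one of the trees attached to the spine.

   For the converse only the tree order matters, since a topological minor
   T <= U yields an order embedding of T in U. If a < b, then two of the trees
   attached to the spine of T_b contain T_a, so T_b has two copies of T_a with
   incomparable roots. An order embedding of T_b in T_a cannot send both roots
   to the spine of T_a, which is a chain; the copy whose root leaves the spine
   is mapped into a single attached T_c with c < a, as the attached trees are
   upward closed. This contradicts the induction hypothesis for c < a. *)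

From mathcomp Require Import all_boot all_order.
From mathcomp Require Import boolp.
From mathcomp Require wochoice.
Require Import Defs.

Set Implicit Arguments.
Unset Strict Implicit.
Unset Printing Implicit Defensive.

Import Order.TTheory.

(** * Simple paths and the tree order *)

(** If the paths part at [x] towards [y] and [z], following [p] and returning along [q] is a walk
    from [y] to [z] that avoids [x]; shortened and closed through [x], it is a cycle of length at
    least three. *)
Lemma simple_path_unique (V : eqType) (E : rel V) (x : V) (p q : seq V) :
  symmetric E -> acyclic E ->
  path E x p -> uniq (x :: p) -> path E x q -> uniq (x :: q) ->
  last x p = last x q -> p = q.
Proof.
move=> symE acE; elim: p x q => [|y p IH] x [|z q] //=.
- by move=> _ _ _ /andP[xq _] xl; rewrite xl mem_last in xq.
- by move=> _ /andP[xp _] _ _ xl; rewrite -xl mem_last in xp.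
move=> /andP[exy pp] /andP[xp up] /andP[exz pq] /andP[xq uq] lpq.
have [yz|nyz] := eqVneq y z; first by subst z; rewrite (IH y q).
exfalso; pose w := p ++ rev (belast z q).
have pw : path E y w.
  rewrite /w cat_path pp /= lpq rev_path.
  by rewrite (eq_path (e' := E)) // => u v /=; rewrite symE.
have lw : last y w = z.
  rewrite last_cat lpq; case: (q) => //= a s.
  by rewrite rev_cons last_rcons.
have xw : x \notin y :: w.
  rewrite -cat_cons mem_cat mem_rev negb_or xp.
  by apply: contra xq => /mem_belast.
case/shortenP: pw lw => w' pw' uw' sub lw'.
have uc : ucycle E (x :: y :: w').
  rewrite /ucycle /= rcons_path exy pw' lw' symE exz /=.
  move: uw' => /= ->; rewrite andbT; apply: contra xw.
  by rewrite !inE => /orP[->//|/sub->]; rewrite orbT.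
have := acE _ uc; case: w' lw' {pw' uw' sub uc} => //= yz.
by rewrite yz eqxx in nyz.
Qed.

Section TreeOrder.
Variable T : rtree.
Implicit Types a b : T.

(** Every walk from the root shortens to the unique simple path, so walks can test the order without
    a check of simplicity. *)
Lemma tree_leP a b : tree_le a b <->
  forall p, path adj root p -> last root p = b -> a \in root :: p.
Proof.
have tT := rtree_tree T; split=> [[p [pp up lp ap]] q pq lq|h].
  case/shortenP: pq lq => q' pq' uq' sub lq.
  have epq : p = q'.
    apply: (simple_path_unique (tree_sym tT) (tree_acyclic tT) pp up) => //.
    by rewrite lp.
  move: ap; rewrite epq !inE => /orP[->//|/sub ->]; exact: orbT.
have [p pp lp] := tree_connected tT (x := root) (y := b) isT isT.
case/shortenP: pp lp => p' pp' up' _ lp.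
by exists p'; split=> //; apply: h.
Qed.

Lemma root_tree_le a : tree_le root a.
Proof. by apply/tree_leP => p _ _; exact: mem_head. Qed.

Lemma tree_le_refl a : tree_le a a.
Proof. by apply/tree_leP => p _ <-; exact: mem_last. Qed.

Lemma tree_le_anti a b : tree_le a b -> tree_le b a -> a = b.
Proof.
move=> [p [pp up lp ap]] /tree_leP h.
(* The part [p1] of the simple path to [b] ends in [a], hence meets [b]; as [b] is also the last
   vertex, nothing can follow [a]. *)
case/splitPl: ap pp up lp => p1 p2 l1.
rewrite cat_path -cat_cons cat_uniq last_cat.
move=> /andP[pp1 _] /and3P[_ dis _] lp.
have := h _ pp1 l1; rewrite -lp; case: p2 dis {lp} => [_|c p2 dis] //=.
move=> bp; case/hasP: dis; exists (last c p2); last exact: bp.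
exact: mem_last.
Qed.

End TreeOrder.

Definition order_embedding (T U : rtree) (f : T -> U) : Prop :=
  forall x y, tree_le x y <-> tree_le (f x) (f y).

Lemma order_embedding_comp (T U W : rtree) (g : U -> W) (f : T -> U) :
  order_embedding g -> order_embedding f -> order_embedding (g \o f).
Proof. by move=> og of_ x y; rewrite /= -og. Qed.

(* The walk from [root] to [f y] that passes through [f root] and then follows
   the image of the path to [y] meets the image of [f] above [f root] only in
   the image of that path. *)
Lemma homo_order_embedding (T U : rtree) (f : T -> U) :
  injective f -> (forall x y, adj x y -> adj (f x) (f y)) ->
  (forall x y, tree_le x y -> tree_le (f x) (f y)) -> order_embedding f.
Proof.
move=> injf adjf lef x y; split=> [/lef//|lexy].
apply/tree_leP => p pp lp.
have [q [pq uq lq _]] := tree_le_refl (f root).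
have : f x \in root :: (q ++ map f p).
  move/tree_leP: lexy; apply; last by rewrite last_cat lq last_map lp.
  rewrite cat_path pq lq /= path_map.
  by apply: sub_path pp => u v /= /adjf.
rewrite -cat_cons mem_cat => /orP[fq|]; last first.
  by rewrite (mem_map injf) inE => ->; rewrite orbT.
have /(tree_le_anti (lef _ _ (root_tree_le x)))/injf <- : tree_le (f x) (f root).
  by exists q.
exact: mem_head.
Qed.

(** * Subdivisions *)

Section Subdivision.
Variables (T T' : rtree) (b : T -> T') (sub : T -> T -> seq T').
Hypothesis hsub : is_subdivision b sub.

(** The start [b x] is omitted, to match the convention of [path]. *)
Fixpoint subdivide (x : T) (p : seq T) : seq T' :=
  if p is y :: p' then sub x y ++ b y :: subdivide y p' else [::].

Lemma last_subdivide x p : last (b x) (subdivide x p) = b (last x p).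
Proof. by elim: p x => //= y p IH x; rewrite last_cat /= IH. Qed.

Lemma subdivide_path x p : path adj x p -> path adj (b x) (subdivide x p).
Proof.
elim: p x => //= y p IH x /andP[exy pp].
have [] := subdiv_path hsub exy.
by rewrite rcons_path cat_path /= IH // => /andP[-> ->].
Qed.

Lemma mem_subdivide x p u : path adj x p -> u \in subdivide x p ->
  (exists2 y, y \in p & u = b y) \/
  (exists y z, [/\ adj y z, y \in x :: p, z \in x :: p & u \in sub y z]).
Proof.
elim: p x => //= y p IH x /andP[exy pp].
rewrite mem_cat inE => /or3P[us|/eqP->|/(IH _ pp)].
- by right; exists x, y; split=> //; rewrite !inE eqxx ?orbT.
- by left; exists y; rewrite ?mem_head.
move=> [[z zp ->]|[v [w [evw vp wp us]]]].
  by left; exists z; rewrite // inE zp orbT.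
by right; exists v, w; split=> //; rewrite inE ?vp ?wp orbT.
Qed.

Lemma mem_subdivide_branch x p y : path adj x p ->
  (b y \in b x :: subdivide x p) = (y \in x :: p).
Proof.
elim: p x => [|z p IH] x /=; first by rewrite !inE (inj_eq (subdiv_inj hsub)).
move=> /andP[exz pp]; rewrite inE mem_cat IH //.
by rewrite (negbTE (subdiv_new hsub y exz)) (inj_eq (subdiv_inj hsub)).
Qed.

Lemma subdivide_uniq x p :
  path adj x p -> uniq (x :: p) -> uniq (b x :: subdivide x p).
Proof.
elim: p x => //= y p IH x /andP[exy pp] /andP[xp up].
have [_] := subdiv_path hsub exy.
rewrite /subdivision_path /= mem_rcons rcons_uniq inE negb_or.
move=> /and3P[/andP[_ bxs] bys us].
have bx : b x \notin b y :: subdivide y p by rewrite mem_subdivide_branch.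
have uy : uniq (b y :: subdivide y p) by exact: IH.
rewrite mem_cat negb_or bxs bx cat_uniq us uy /= negb_or bys andbT /=.
apply/hasPn => u /(mem_subdivide pp)[[z _ ->]|].
  exact: subdiv_new exy.
(* By independence a shared new vertex would identify the edge [v w] with [x y], so that the simple
   path would return to [x]. *)
move=> [v [w [evw vp wp uvw]]]; apply/negP => uxy.
by have [[xv _]|[xw _]] := subdiv_indep hsub exy evw uxy uvw;
  move: xp; rewrite ?xv ?xw ?vp ?wp.
Qed.

(** Subdividing a path neither adds nor loses vertices of the form [b y]. Simple paths give one
    direction, arbitrary walks the other. *)
Lemma subdivision_order_embedding : order_embedding b.
Proof.
move=> x y; split=> [[p [pp up lp xp]]|/tree_leP h].
  exists (subdivide root p); rewrite -(subdiv_root hsub).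
  split; [exact: subdivide_path|exact: subdivide_uniq| |].
    by rewrite last_subdivide lp.
  by rewrite mem_subdivide_branch.
apply/tree_leP => p pp lp; rewrite -mem_subdivide_branch //.
rewrite (subdiv_root hsub); apply: h; rewrite -(subdiv_root hsub).
  exact: subdivide_path.
by rewrite last_subdivide lp.
Qed.

End Subdivision.

Lemma topological_minor_order_embedding (T U : rtree) :
  topological_minor T U -> exists f : T -> U, order_embedding f.
Proof.
move=> [T' [[b [sub hsub]] [S [F [phi [[tF Fadj] [injp _ Fphi] lep]]]]]].
have ophi : order_embedding phi.
  by apply: homo_order_embedding => // x y; rewrite -Fphi => /Fadj.
exists (phi \o b); apply: order_embedding_comp ophi _.
exact: subdivision_order_embedding hsub.
Qed.

(** * Copies of a tree inside another *)

(** The root may go to any vertex, so preservation of the order has to be demanded separately. *)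
Record copy (T U : rtree) (f : T -> U) : Prop := Copy {
  copy_inj : injective f;
  copy_adj : {mono f : x y / adj x y};
  copy_le : forall x y, tree_le x y -> tree_le (f x) (f y) }.

Lemma copy_order_embedding (T U : rtree) (f : T -> U) : copy f -> order_embedding f.
Proof.
case=> injf adjf lef; apply: homo_order_embedding => // x y.
by rewrite adjf.
Qed.

Lemma copy_id (T : rtree) : copy (@id T).
Proof. by split. Qed.

Lemma copy_comp (T U W : rtree) (g : U -> W) (f : T -> U) :
  copy g -> copy f -> copy (g \o f).
Proof.
move=> [ig ag lg] [i_f af lf]; split=> [|x y|x y /lf/lg//].
  exact: inj_comp.
by rewrite /= ag af.
Qed.

Lemma root_homo_copy (T U : rtree) (f : T -> U) :
  injective f -> {mono f : x y / adj x y} -> f root = root -> copy f.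
Proof.
move=> injf adjf fr; split=> // x y [p [pp up lp xp]].
exists (map f p); rewrite -fr -map_cons (map_inj_uniq injf) up last_map lp.
by rewrite (mem_map injf) xp path_map (eq_path (e' := adj)).
Qed.

Lemma rtree_iso_copy T U : rtree_iso T U ->
  (exists f : T -> U, copy f) /\ (exists g : U -> T, copy g).
Proof.
move=> [f [[g fK gK] fr adjf]]; split.
  by exists f; apply: root_homo_copy => //; exact: can_inj fK.
exists g; apply: root_homo_copy; first exact: can_inj gK.
  by move=> x y; rewrite -adjf !gK.
by rewrite -fr fK.
Qed.

Lemma trivial_subdivision (T : rtree) : subdivision T T.
Proof.
exists id, (fun _ _ => [::]); have tT := rtree_tree T; split=> //.
- move=> x y exy; rewrite /= exy; split=> //.
  rewrite /= inE andbT; apply: contraTN exy => /eqP->.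
  by rewrite (tree_irr tT).
- by move=> u; left; exists u.
- by move=> u v euv; exists u, v; split=> //; exact: infix_refl.
Qed.

Lemma copy_topological_minor (T U : rtree) (f : T -> U) :
  copy f -> topological_minor T U.
Proof.
case=> injf adjf lef; exists T; split; first exact: trivial_subdivision.
have [tT tU] := (rtree_tree T, rtree_tree U).
pose S : pred U := fun u => `[< exists x, f x = u >].
pose F : rel U := fun u v => [&& S u, S v & adj u v].
have Sf x : S (f x) by apply/asboolP; exists x.
have FE x y : F (f x) (f y) = adj x y by rewrite /F !Sf adjf.
exists S, F, f; split=> //; last by split=> // u; split=> /asboolP.
split; last by move=> x y /and3P[].
split.
- by move=> u v; rewrite /F andbCA (tree_sym tU).
- by move=> u; rewrite /F (tree_irr tU) !andbF.
- by move=> u v /and3P[-> ->].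
- by exists (f root).
- move=> _ _ /asboolP[x <-] /asboolP[y <-].
  have [p pp <-] := tree_connected tT (x := x) (y := y) isT isT.
  by exists (map f p); rewrite ?last_map // path_map (eq_path (e' := adj)).
- move=> c /andP[cF uc]; apply: (tree_acyclic tU); rewrite /ucycle uc andbT.
  by apply: sub_cycle cF => u v /and3P[].
Qed.

(** * The tree order of an attachment *)

Section AttachOrder.
Variables (T : rtree) (X : T -> rtree).

Definition spine (v : T) : attach X := inl v.
Definition attached (v : T) (x : X v) : attach X := inr (Tagged X x).

Lemma spine_inj : injective spine. Proof. by move=> v w []. Qed.

Lemma attached_inj v : injective (@attached v).
Proof. by move=> x y [] /eqP; rewrite eq_Tagged => /eqP. Qed.

Lemma spine_root : spine root = root. Proof. by []. Qed.

Lemma spine_copy : copy spine.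
Proof. exact: root_homo_copy spine_inj _ _. Qed.

Lemma attached_adj v : {mono @attached v : x y / adj x y}.
Proof. exact: attach_adjr. Qed.

Lemma path_to_attached v (x : X v) (q : seq T) (p : seq (X v)) :
  path adj root q -> last root q = v ->
  path adj root p -> last root p = x ->
  let w := map spine q ++ map (@attached v) (root :: p) in
  path adj (root : attach X) w /\ last (root : attach X) w = attached x.
Proof.
move=> pq lq pp lp w; rewrite {}/w -spine_root cat_path last_cat path_map.
rewrite last_map lq (eq_path (e' := adj)) // pq /= path_map last_map lp.
by rewrite (eq_path (e' := adj)) ?pp ?eqxx //; exact: attached_adj.
Qed.

Lemma attached_copy v : copy (@attached v).
Proof.
split=> [||x y [p [pp up lp xp]]]; [exact: attached_inj|exact: attached_adj|].
have [q [pq uq lq _]] := tree_le_refl v.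
have [pw lw] := path_to_attached pq lq pp lp.
eexists; split; [exact: pw| |exact: lw|].
  rewrite -cat_cons -spine_root -map_cons cat_uniq.
  rewrite (map_inj_uniq spine_inj) (map_inj_uniq (@attached_inj v)) uq up.
  by rewrite andbT; apply/hasPn => _ /mapP[z _ ->]; apply/mapP => -[].
by rewrite -cat_cons mem_cat (mem_map (@attached_inj v)) xp orbT.
Qed.

(** Some walk from the root to [c] stays in the base tree, except for a final part inside the copy
    that contains [c], if any. It must meet [x], so that copy is the one at [v]. *)
Lemma attached_upclosed v (x : X v) (c : attach X) :
  tree_le (attached x) c -> exists y : X v, c = attached y.
Proof.
have nspine (q : seq T) : attached x \notin map spine q.
  by apply/mapP => -[].
case: c => [w|[w y]] /tree_leP h.
  have [q pq lq] := tree_connected (rtree_tree T) (x := root) (y := w) isT isT.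
  have := h (map spine q); rewrite -spine_root path_map last_map lq.
  by move=> /(_ pq erefl); rewrite -map_cons (negbTE (nspine _)).
have [q pq lq] := tree_connected (rtree_tree T) (x := root) (y := w) isT isT.
have [p pp lp] :=
  tree_connected (rtree_tree (X w)) (x := root) (y := y) isT isT.
have [pw lw] := path_to_attached pq lq pp lp.
have := h _ pw lw; rewrite -cat_cons mem_cat => /orP[|/mapP[z _ []]].
  by rewrite -spine_root -map_cons (negbTE (nspine _)).
by move=> vw _; clear -vw; subst w; exists y.
Qed.

Lemma attached_incomparable v w (x : X v) (y : X w) :
  v != w -> ~ tree_le (attached x) (attached y).
Proof.
move=> nvw /attached_upclosed[z [] wv _].
by rewrite wv eqxx in nvw.
Qed.

End AttachOrder.

Lemma ray_total (i j : ray) : tree_le i j \/ tree_le j i.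
Proof.
wlog le_ij : i j / i <= j => [H|].
  by have [/H//|/ltnW/H[]] := leqP i j; [right|left].
left; exists (iota 1 j); rewrite -[_ :: _]/(iota 0 j.+1) iota_uniq mem_iota /=.
split=> //; last 1 first.
- suff h n k : last k (iota k.+1 n) = k + n :> nat by rewrite (h j 0).
  by elim: n k => [|n IH] k /=; rewrite ?addn0 // IH addSnnS.
suff h n k : path ray_adj k (iota k.+1 n) by exact: h j 0.
by elim: n k => //= n IH k; rewrite IH /ray_adj eqxx.
Qed.

(** * The trees *)

Section Family.
Variables (d : Order.disp_t) (O : orderType d).
Hypothesis wo : wochoice.well_order (<=%O : rel O).

Lemma ordinal_ind (P : O -> Prop) :
  (forall b, (forall a, (a < b)%O -> P a) -> P b) -> forall b, P b.
Proof.
move=> step b; apply: contrapT => nPb.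
pose A : pred O := fun c => `[< ~ P c >].
have [|c [[/asboolP nPc minc] _]] := wo (A := A).
  by exists b; apply/asboolP.
apply: nPc; apply: step => a ac; apply: contrapT => nPa.
by have := minc a (asboolT nPa); rewrite leNgt ac.
Qed.

Lemma lt_is_one (a b : O) : is_one b -> (a < b)%O -> is_zero a.
Proof.
move=> [z z0 [_ zb]] ab; suff -> : a = z by [].
by apply/eqP; rewrite eq_le z0 andbT leNgt; apply/negP => /zb; rewrite leNgt ab.
Qed.

Variables (psi : O -> nat -> O) (T : O -> rtree).
Hypotheses (hpsi : admissible psi) (hT : tree_family psi T).

(** Treats successors and limits alike. Cofinality is stated with two distinct indices because the
    non-embedding argument needs two incomparable copies. *)
Lemma family_cases b : ~ is_zero b ->
  (is_one b /\ rtree_iso (T b) ray) \/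
  exists X : nat -> O,
    [/\ rtree_iso (T b) (attach (T := ray) (fun n => T (X n))),
        (forall n, ~ is_zero (X n) /\ (X n < b)%O)
      & forall a, (a < b)%O -> exists m n,
          [/\ m < n, (a <= X m)%O & (a <= X n)%O]].
Proof.
move=> bn0; have [[c cb]|nsucc] := pselect (exists c, is_succ c b).
  have [c0|cn0] := pselect (is_zero c).
    have b1 : is_one b by exists c.
    by left; split; [exact: b1 | exact: (family_one hT b1)].
  right; exists (fun=> c); split; first exact: (family_succ hT cn0 cb).
    by move=> _; split=> //; case: cb.
  move=> a ab; have ac : (a <= c)%O.
    by rewrite leNgt; apply/negP => /cb.2; rewrite leNgt ab.
  by exists 0, 1.
have lb : is_limit b by split=> // c cb; apply: nsucc; exists c.
have [psilt psiinc psicof] := hpsi lb.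
right; exists (psi b); split=> //; first exact: (family_limit hT lb).
(* Monotonicity of [psi b] supplies the second index. *)
move=> a /psicof[n an]; exists n, n.+1; split=> //.
by apply: le_trans an (ltW _); exact: psiinc.
Qed.

(** The weak inequality lets the induction reach an attached tree that is [T a] itself. *)
Lemma family_copy a b : ~ is_zero a -> (a <= b)%O ->
  exists f : T a -> T b, copy f.
Proof.
move=> an0; elim/ordinal_ind: b => b IH.
rewrite le_eqVlt => /orP[/eqP<-|ab]; first by exists id; exact: copy_id.
have bn0 : ~ is_zero b by move=> /(_ a); rewrite leNgt ab.
have [[b1 _]|[X [/rtree_iso_copy[_ [h ch]] Xlt Xcof]]] := family_cases bn0.
  by case: an0; exact: lt_is_one b1 ab.
have [m [_ [_ am _]]] := Xcof a ab.
have [f cf] := IH _ (Xlt m).2 am.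
have cA := @attached_copy ray (fun n => T (X n)) m.
eexists; exact: (copy_comp ch (copy_comp cA cf)).
Qed.

(** Induction on [a] with [b] free: the hypothesis is applied to some [Y j] below [a], with [a] in
    the role of [b]. *)
Lemma family_no_order_embedding a b : ~ is_zero a -> (a < b)%O ->
  ~ exists f : T b -> T a, order_embedding f.
Proof.
elim/ordinal_ind: a b => a IH b an0 ab [f of_].
have bn0 : ~ is_zero b by move=> /(_ a); rewrite leNgt ab.
have [[b1 _]|[X [/rtree_iso_copy[_ [h ch]] Xlt Xcof]]] := family_cases bn0.
  by case: an0; exact: lt_is_one b1 ab.
have oh := copy_order_embedding ch.
have [m [n [mn am an]]] := Xcof a ab.
have [gm cm] := family_copy an0 am.
have [gn cn] := family_copy an0 an.
pose A := @attached ray (fun k => T (X k)).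
have copies k (g : T a -> T (X k)) :
    copy g -> order_embedding (f \o (h \o (A k \o g))).
  move=> cg; apply: order_embedding_comp of_ _; apply: copy_order_embedding.
  exact: (copy_comp ch (copy_comp (@attached_copy ray (fun k => T (X k)) k) cg)).
have [oem oen] := (copies m gm cm, copies n gn cn).
set em := f \o _ in oem; set en := f \o _ in oen.
have inc_mn : ~ tree_le (em root) (en root).
  by rewrite -of_ -oh; apply: attached_incomparable; rewrite neq_ltn mn.
have inc_nm : ~ tree_le (en root) (em root).
  by rewrite -of_ -oh; apply: attached_incomparable; rewrite neq_ltn mn orbT.
have [[_ /rtree_iso_copy[[k ck] _]]|[Y [/rtree_iso_copy[[k ck] _] Ylt _]]] :=
    family_cases an0.
  (* Here [T a] is a ray, whose order is total. *)
  have ok := copy_order_embedding ck.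
  by have [/ok|/ok] := ray_total (k (em root)) (k (en root)).
have ok := copy_order_embedding ck.
(* If the image of the root lies off the spine, upward closure confines all of [e] to one attached
   tree, which embeds [T a] in [T (Y j)]. *)
have into_attached (e : T a -> T a) j (y : T (Y j)) : order_embedding e ->
    k (e root) = @attached ray (fun i => T (Y i)) j y -> False.
  move=> oe ke.
  have up x : {y' : T (Y j) |
      k (e x) = @attached ray (fun i => T (Y i)) j y'}.
    apply: cid; apply: (@attached_upclosed ray _ j y); rewrite -ke -ok -oe.
    exact: root_tree_le.
  apply: (IH (Y j) (Ylt j).2 a (Ylt j).1 (Ylt j).2).
  exists (fun x => sval (up x)) => u v.
  rewrite (copy_order_embedding (@attached_copy ray (fun i => T (Y i)) j)).
  by rewrite -(svalP (up u)) -(svalP (up v)) -ok -oe.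
case Em : (k (em root)) => [i|[i y]]; last exact: into_attached oem Em.
case En : (k (en root)) => [j|[j y]]; last exact: into_attached oen En.
(* Both roots now lie on the spine, hence are comparable. *)
have osp := copy_order_embedding (@spine_copy ray (fun i => T (Y i))).
have [/osp|/osp] := ray_total i j; by rewrite /spine -Em -En => /ok.
Qed.

End Family.

Theorem theorem1 (d : Order.disp_t) (O : orderType d) (homega1 : omega1 O)
    (psi : O -> nat -> O) (hpsi : admissible psi)
    (T : O -> rtree) (hT : tree_family psi T) (a b : O) :
  ~ is_zero a -> (a < b)%O ->
  topological_minor (T a) (T b) /\ ~ topological_minor (T b) (T a).
Proof.
move=> an0 ab; have [wo _ _] := homega1; split.
  have [f cf] := family_copy wo hpsi hT an0 (ltW ab).
  exact: copy_topological_minor cf.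
move/topological_minor_order_embedding.
exact: family_no_order_embedding wo _ _ hpsi hT _ _ an0 ab.
Qed.
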